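(* Let $\mathrm{pr}\colon\mathbb{R}^3\to\mathbb{R}^2$, $\mathrm{pr}(x,y,z)=(x,y)$, be the projection. The map $p\colon\mathrm{cw}(\mathbb{R}^3)\to\mathrm{cw}(\mathbb{R}^2)$, $p(A)=\mathrm{pr}(A)$, is not $0$-soft.
   Context: $\mathrm{cc}(\mathbb{R}^n)$ denotes the set of all nonempty compact convex subsets of Euclidean space $\mathbb{R}^n$, with the topology generated by the Hausdorff metric; its subsets carry the subspace topology. For $K\in\mathrm{cc}(\mathbb{R}^n)$, the support function $h_K\colon S^{n-1}\to\mathbb{R}$ is $h_K(u)=\max\{\langle x,u\rangle\mid x\in K\}$, where $\langle\cdot,\cdot\rangle$ is the standard inner product and $S^{n-1}$ is the unit sphere, and the width function is $w_K(u)=h_K(u)+h_K(-u)$. $K$ is of constant width $d>0$ if $w_K$ is the constant function with value $d$. For $d>0$, $\mathrm{cw}_d(\mathbb{R}^n)\subset\mathrm{cc}(\mathbb{R}^n)$ is the set of compact convex bodies of constant width $d$, and $\mathrm{cw}(\mathbb{R}^n)=\bigcup_{d>0}\mathrm{cw}_d(\mathbb{R}^n)$. The image under $\mathrm{pr}$ of a body of constant width $d$ in $\mathbb{R}^3$ is a body of constant width $d$ in $\mathbb{R}^2$, so $p$ is well defined. Maps are continuous. A map $f\colon X\to Y$ is $n$-soft if for every paracompact space $Z$ of covering dimension $\le n$, every closed embedding $i\colon A\to Z$, and all maps $\psi\colon A\to X$, $\varphi\colon Z\to Y$ with $f\psi=\varphi i$, there exists a map $\Phi\colon Z\to X$ such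 that $\Phi i=\psi$ and $f\Phi=\varphi$. The notion $0$-soft is the case $n=0$. *)

(* Defs.v *)
From HB Require Import structures.
From mathcomp Require Import all_boot all_order all_algebra ring lra.
From mathcomp Require Import all_classical all_reals all_analysis.

Set Implicit Arguments.
Unset Strict Implicit.
Unset Printing Implicit Defensive.

Import Order.TTheory GRing.Theory Num.Theory.
Import numFieldNormedType.Exports.

Local Open Scope classical_set_scope.
Local Open Scope card_scope.
Local Open Scope ring_scope.

Section CoveringDimension.
Variable Z : topologicalType.
Implicit Types F G : set (set Z).

Definition open_cover F := F `<=` open /\ \bigcup_(U in F) U = [set: Z].

Definition refines G F := forall V, G V -> exists2 U, F U & V `<=` U.

Definition locally_finite F := forall z : Z,
  exists2 W, nbhs z W & finite_set [set V | F V /\ V `&` W !=set0].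

(** Paracompact spaces are Hausdorff by convention (as in Engelking). *)
Definition paracompact := hausdorff_space Z /\
  forall F, open_cover F ->
    exists G, [/\ open_cover G, refines G F & locally_finite G].

(** The Cech-Lebesgue dimension, tested on finite covers; on paracompact spaces
    arbitrary open covers give the same notion. *)
Definition covering_dim_le (n : nat) :=
  forall F, finite_set F -> open_cover F ->
    exists G, [/\ finite_set G, open_cover G, refines G F &
      forall z, [set V | G V /\ V z] #<= `I_n.+1].

End CoveringDimension.

Arguments paracompact : clear implicits.
Arguments covering_dim_le : clear implicits.

Definition closed_embedding (A Z : topologicalType) (i : A -> Z) :=
  [/\ continuous i, injective i & forall C, closed C -> closed (i @` C)].

Definition soft (n : nat) (X Y : topologicalType) (f : continuousType X Y) :=
  forall (Z A : topologicalType) (i : A -> Z),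
    paracompact Z -> covering_dim_le Z n -> closed_embedding i ->
  forall (psi : continuousType A X) (phi : continuousType Z Y),
    f \o psi = phi \o i ->
  exists Phi : continuousType Z X, Phi \o i = psi /\ f \o Phi = phi.

(** The library norm on ['rV_n] is the sup norm, so the Euclidean one is defined
    here; both induce the library topology of ['rV_n]. *)

Section Euclidean.
Context {R : realType}.

Definition dot n (u v : 'rV[R]_n) : R := \sum_i u 0 i * v 0 i.

Definition enorm n (u : 'rV[R]_n) : R := Num.sqrt (dot u u).

Definition edist n (u v : 'rV[R]_n) : R := enorm (u - v).

Definition sphere n : set 'rV[R]_n := [set u | enorm u = 1].

Lemma dotC n (u v : 'rV[R]_n) : dot u v = dot v u.
Proof. by apply: eq_bigr => i _; rewrite mulrC. Qed.

Lemma dotDl n (u v w : 'rV[R]_n) : dot (u + v) w = dot u w + dot v w.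
Proof. by rewrite -big_split; apply: eq_bigr => i _; rewrite mxE mulrDl. Qed.

Lemma dotZl n a (u w : 'rV[R]_n) : dot (a *: u) w = a * dot u w.
Proof. by rewrite mulr_sumr; apply: eq_bigr => i _; rewrite mxE mulrA. Qed.

Lemma dotDr n (u v w : 'rV[R]_n) : dot w (u + v) = dot w u + dot w v.
Proof. by rewrite dotC dotDl !(dotC w). Qed.

Lemma dotZr n a (u w : 'rV[R]_n) : dot w (a *: u) = a * dot w u.
Proof. by rewrite dotC dotZl (dotC w). Qed.

Lemma dot_ge0 n (u : 'rV[R]_n) : 0 <= dot u u.
Proof. by apply: sumr_ge0 => i _; rewrite -expr2 sqr_ge0. Qed.

Lemma dot_eq0 n (u : 'rV[R]_n) : dot u u = 0 -> u = 0.
Proof.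
move=> /eqP; rewrite psumr_eq0 => [/allP u0|i _]; last by rewrite -expr2 sqr_ge0.
apply/rowP => i; rewrite mxE; apply/eqP.
by have := u0 i; rewrite mem_index_enum mulf_eq0 orbb => /(_ isT).
Qed.

Lemma cauchy_schwarz n (u v : 'rV[R]_n) :
  dot u v ^+ 2 <= dot u u * dot v v.
Proof.
have [v0|v0] := eqVneq (dot v v) 0.
  rewrite (dot_eq0 v0) -(scale0r (0 : 'rV_n)) !dotZr !mul0r mulr0.
  by rewrite expr0n.
have vp : 0 < dot v v by rewrite lt_neqAle eq_sym v0 dot_ge0.
have := dot_ge0 (dot v v *: u + (- dot u v) *: v).
rewrite !(dotDl, dotDr, dotZl, dotZr) (dotC v u) => h.
rewrite -(ler_pM2l vp) -subr_ge0; apply: le_trans h _.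
by rewrite le_eqVlt; apply/orP; left; apply/eqP; ring.
Qed.

Lemma enorm_ge0 n (u : 'rV[R]_n) : 0 <= enorm u.
Proof. exact: sqrtr_ge0. Qed.

Lemma enormD n (u v : 'rV[R]_n) : enorm (u + v) <= enorm u + enorm v.
Proof.
have pos : 0 <= enorm u + enorm v by rewrite addr_ge0 ?enorm_ge0.
rewrite -(ger0_norm pos) -sqrtr_sqr ler_wsqrtr// sqrrD !sqr_sqrtr ?dot_ge0//.
rewrite !(dotDl, dotDr) (dotC v u).
have : dot u v <= enorm u * enorm v.
  rewrite -sqrtrM ?dot_ge0// (le_trans (ler_norm _))// -sqrtr_sqr.
  by rewrite ler_wsqrtr// cauchy_schwarz.
by move: (dot u u) (dot v v) (dot u v) (enorm u * enorm v) => a b c d; lra.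
Qed.

Lemma enormN n (u : 'rV[R]_n) : enorm (- u) = enorm u.
Proof. by rewrite /enorm -scaleN1r dotZl dotZr mulrA mulrNN !mul1r. Qed.

Lemma edist_ge0 n (u v : 'rV[R]_n) : 0 <= edist u v.
Proof. exact: enorm_ge0. Qed.

Lemma edistC n (u v : 'rV[R]_n) : edist u v = edist v u.
Proof. by rewrite /edist -enormN opprB. Qed.

Lemma edist_triangle n (v u w : 'rV[R]_n) : edist u w <= edist u v + edist v w.
Proof. by rewrite /edist -(subrKA v) enormD. Qed.

Lemma edistxx n (u : 'rV[R]_n) : edist u u = 0.
Proof. by rewrite /edist /enorm subrr -(scale0r 0) dotZl mul0r sqrtr0. Qed.

Lemma edist_eq0 n (u v : 'rV[R]_n) : edist u v = 0 -> u = v.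
Proof.
move=> /eqP; rewrite sqrtr_eq0 => uv; apply/eqP; rewrite -subr_eq0; apply/eqP.
by apply: dot_eq0; apply/eqP; rewrite eq_le uv dot_ge0.
Qed.

Lemma dot_continuous n (v : 'rV[R]_n) : continuous (fun u => dot u v).
Proof.
apply: continuous_big => [|i _ u]; first exact: add_continuous.
have cu : {for u, continuous (fun w : 'rV[R]_n => w 0 i)}.
  exact: coord_continuous.
exact: (cvgM cu (cvg_cst _)).
Qed.

Lemma edist_continuous n (v : 'rV[R]_n) : continuous (fun u => edist v u).
Proof.
have dc : continuous (fun u : 'rV[R]_n => dot (v - u) (v - u)).
  apply: continuous_big => [|i _ u]; first exact: add_continuous.
  have cu : {for u, continuous (fun w : 'rV[R]_n => (v - w) 0 i)}.
    rewrite (_ : (fun w : 'rV[R]_n => _) = (fun w => v 0 i - w 0 i)).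
      apply: continuousB; first exact: cst_continuous.
      exact: coord_continuous.
    by apply/funext => w; rewrite !mxE.
  exact: (cvgM cu cu).
by move=> u; apply: (continuous_comp (dc u)); exact: sqrt_continuous.
Qed.

End Euclidean.

Record cc (R : realType) (n : nat) := CC {
  body :> set 'rV[R]_n;
  body_nonempty : body !=set0;
  body_compact : compact body;
  body_convex : convex_set body
}.

Arguments body_nonempty {R n} c.
Arguments body_compact {R n} c.
Arguments body_convex {R n} c.

HB.instance Definition _ (R : realType) n := gen_eqMixin (cc R n).
HB.instance Definition _ (R : realType) n := gen_choiceMixin (cc R n).

Section Hausdorff.
Context {R : realType}.

Definition dist_to_set n (B : set 'rV[R]_n) (a : 'rV[R]_n) : R :=
  inf [set edist a b | b in B].

Definition excess n (A B : set 'rV[R]_n) : R := sup (dist_to_set B @` A).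

Definition hausdorff_dist n (A B : set 'rV[R]_n) : R :=
  Num.max (excess A B) (excess B A).

Lemma cc_inj n (A B : cc R n) : A = B :> set _ -> A = B.
Proof.
case: A B => A A0 Ac Ax [B B0 Bc Bx] /= AB; subst B.
by congr CC; exact: Prop_irrelevance.
Qed.

Lemma dist_to_set_le n (B : set 'rV[R]_n) a b : B b ->
  dist_to_set B a <= edist a b.
Proof.
move=> Bb; apply: ge_inf; last by exists b.
by exists 0 => _ [c _ <-]; exact: edist_ge0.
Qed.

Lemma dist_to_set_attained n (B : cc R n) a :
  exists2 b, body B b & dist_to_set B a = edist a b.
Proof.
have [b bB bmin] := EVT_min_rV (body_nonempty B) (body_compact B)
  (continuous_subspaceT (@edist_continuous R n a)).
rewrite inE in bB; exists b => //; apply/eqP; rewrite eq_le dist_to_set_le//=.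
apply: lb_le_inf; first by exists (edist a b), b.
by move=> _ [c Bc <-]; apply: bmin; rewrite inE.
Qed.

Lemma dist_to_set_ge0 n (B : cc R n) a : 0 <= dist_to_set B a.
Proof. by have [b _ ->] := dist_to_set_attained B a; exact: edist_ge0. Qed.

Lemma dist_to_set_has_sup n (A B : cc R n) : has_sup (dist_to_set B @` A).
Proof.
split; first exact/image_nonempty/body_nonempty.
have [b Bb] := body_nonempty B.
have [a _ amax] := EVT_max_rV (body_nonempty A) (body_compact A)
  (continuous_subspaceT (@edist_continuous R n b)).
exists (edist b a) => _ [c Ac <-].
by rewrite (le_trans (dist_to_set_le _ Bb))// edistC amax// inE.
Qed.

Lemma dist_to_set_le_excess n (A B : cc R n) a :
  body A a -> dist_to_set B a <= excess A B.
Proof.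
by move=> Aa; apply: sup_upper_bound; [exact: dist_to_set_has_sup|exists a].
Qed.

Lemma excess_le n (A B : cc R n) e :
  (forall a, body A a -> dist_to_set B a <= e) -> excess A B <= e.
Proof.
move=> h; apply: ge_sup; first by case: (dist_to_set_has_sup A B).
by move=> _ [a Aa <-]; exact: h.
Qed.

Lemma excess_ge0 n (A B : cc R n) : 0 <= excess A B.
Proof.
have [a Aa] := body_nonempty A.
exact: le_trans (dist_to_set_ge0 B a) (dist_to_set_le_excess B Aa).
Qed.

Lemma excess_triangle n (B A C : cc R n) :
  excess A C <= excess A B + excess B C.
Proof.
apply: excess_le => a Aa; have [b Bb dab] := dist_to_set_attained B a.
have [c Cc dbc] := dist_to_set_attained C b.
apply: le_trans (dist_to_set_le a Cc) _.
apply: le_trans (edist_triangle b _ _) _.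
by rewrite lerD -?dab -?dbc ?dist_to_set_le_excess.
Qed.

Lemma excess_eq0 n (A B : cc R n) : excess A B = 0 -> A `<=` B.
Proof.
move=> e0 a Aa; have [b Bb dab] := dist_to_set_attained B a.
suff -> : a = b by [].
apply: edist_eq0; apply/eqP; rewrite -dab eq_le dist_to_set_ge0 andbT -e0.
exact: dist_to_set_le_excess.
Qed.

Lemma hausdorff_distxx n (A : cc R n) : hausdorff_dist A A = 0.
Proof.
rewrite /hausdorff_dist maxxx; apply/eqP; rewrite eq_le excess_ge0 andbT.
by apply: excess_le => a Aa; rewrite -(edistxx a) dist_to_set_le.
Qed.

Lemma hausdorff_dist_eq0 n (A B : cc R n) : hausdorff_dist A B = 0 -> A = B.
Proof.
move=> d0; apply: cc_inj; apply/seteqP.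
split; apply: excess_eq0; apply/eqP; rewrite eq_le excess_ge0 andbT -d0;
  by rewrite /hausdorff_dist le_max lexx ?orbT.
Qed.

Lemma hausdorff_distC n (A B : cc R n) :
  hausdorff_dist A B = hausdorff_dist B A.
Proof. by rewrite /hausdorff_dist maxC. Qed.

Lemma hausdorff_dist_triangle n (B A C : cc R n) :
  hausdorff_dist A C <= hausdorff_dist A B + hausdorff_dist B C.
Proof.
rewrite /hausdorff_dist ge_max; apply/andP; split.
  by apply: le_trans (excess_triangle B _ _) _; rewrite lerD// le_max lexx.
apply: le_trans (excess_triangle B _ _) _.
by rewrite addrC lerD// le_max lexx orbT.
Qed.

HB.instance Definition _ n := isMetric.Build R (cc R n)
  (@hausdorff_distxx n) (@hausdorff_dist_eq0 n) (@hausdorff_distC n)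
  (@hausdorff_dist_triangle n).

End Hausdorff.

Section ConstantWidth.
Context {R : realType}.

(** Only the values at unit vectors [u] matter below.  The supremum is a maximum
    by [support_max]. *)
Definition support n (K : set 'rV[R]_n) (u : 'rV[R]_n) : R :=
  sup [set dot x u | x in K].

Lemma support_max n (K : cc R n) u : exists2 x, body K x &
  support K u = dot x u /\ forall y, body K y -> dot y u <= dot x u.
Proof.
have [x xK xmax] := EVT_max_rV (body_nonempty K) (body_compact K)
  (continuous_subspaceT (@dot_continuous R n u)).
rewrite inE in xK.
have {}xmax y : body K y -> dot y u <= dot x u by move=> Ky; apply: xmax; rewrite inE.
exists x => //; split => //; apply/eqP; rewrite eq_le; apply/andP; split.
  by apply: ge_sup; [exists (dot x u), x|move=> _ [y Ky <-]; exact: xmax].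
apply: ub_le_sup; last by exists x.
by exists (dot x u) => _ [y Ky <-]; exact: xmax.
Qed.

Definition width n (K : set 'rV[R]_n) (u : 'rV[R]_n) : R :=
  support K u + support K (- u).

Definition cwd n (d : R) : set (cc R n) :=
  [set K | forall u, sphere u -> width K u = d].

Definition cw n : set (cc R n) := \bigcup_(d in [set d | 0 < d]) @cwd n d.

End ConstantWidth.

Arguments cw R n : clear implicits.

Section Projection.
Context {R : realType}.

Definition pr (v : 'rV[R]_3) : 'rV[R]_2 := @lsubmx R 1 2 1 v.

Definition embed (u : 'rV[R]_2) : 'rV[R]_3 := @row_mx R 1 2 1 u 0.

Lemma dot3 (u v : 'rV[R]_3) :
  dot u v = dot (pr u) (pr v) + u 0 ord_max * v 0 ord_max.
Proof.
rewrite /dot big_ord_recr /=; congr (_ + _); apply: eq_bigr => i _.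
by rewrite !mxE; congr (u _ _ * v _ _); exact: val_inj.
Qed.

Lemma pr_embed u : pr (embed u) = u. Proof. exact: row_mxKl. Qed.

Lemma embed_last u : embed u 0 ord_max = 0.
Proof.
have -> : ord_max = @rshift 2 1 ord0 by exact: val_inj.
by rewrite [LHS](@row_mxEr _ _ 2 1) mxE.
Qed.

Lemma prB u v : pr (u - v) = pr u - pr v.
Proof. exact: (linearB (@lsubmx R 1 2 1)). Qed.

Lemma dot_pr (x : 'rV[R]_3) u : dot (pr x) u = dot x (embed u).
Proof. by rewrite dot3 pr_embed embed_last mulr0 addr0. Qed.

Lemma enorm_pr_le (x : 'rV[R]_3) : enorm (pr x) <= enorm x.
Proof. by rewrite ler_wsqrtr// (dot3 x) lerDl -expr2 sqr_ge0. Qed.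

Lemma edist_pr_le (x y : 'rV[R]_3) : edist (pr x) (pr y) <= edist x y.
Proof. by rewrite /edist -prB enorm_pr_le. Qed.

Lemma pr_continuous : continuous pr.
Proof.
move=> x U /nbhs_ballP [e e0 eU]; apply/nbhs_ballP; exists e => //= y [_ xy].
by apply: eU; split => // i j; rewrite !mxE; exact: xy.
Qed.

Lemma pr_nonempty (K : cc R 3) : pr @` K !=set0.
Proof. exact/image_nonempty/body_nonempty. Qed.

Lemma pr_compact (K : cc R 3) : compact (pr @` K).
Proof.
apply: continuous_compact (body_compact K).
exact/continuous_subspaceT/pr_continuous.
Qed.

Lemma pr_convex (K : cc R 3) : convex_set (pr @` K).
Proof.
move=> _ _ t /set_mem[x Kx <-] /set_mem[y Ky <-]; apply/mem_set.
exists (conv t (x : convex_lmodType _) (y : convex_lmodType _)).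
  by apply/set_mem/body_convex; exact/mem_set.
by apply/rowP => i; rewrite !mxE.
Qed.

Definition pr_cc (K : cc R 3) : cc R 2 :=
  CC (pr_nonempty K) (@pr_compact K) (@pr_convex K).

Lemma support_pr (K : cc R 3) u : support (pr_cc K) u = support K (embed u).
Proof.
congr sup; apply/seteqP; split => [_ [_ [x Kx <-] <-]|_ [x Kx <-]].
  by exists x => //; rewrite dot_pr.
by exists (pr x); [exists x|rewrite dot_pr].
Qed.

Lemma pr_cc_cw (K : cc R 3) : cw R 3 K -> cw R 2 (pr_cc K).
Proof.
case=> d d0 Kd; exists d => // u u1; rewrite /width !support_pr.
have -> : embed (- u) = - embed u.
  by rewrite [RHS](@opp_row_mx _ 1 2 1) oppr0.
apply: Kd.
by rewrite /sphere/= /enorm dot3 pr_embed embed_last mulr0 addr0.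
Qed.

Definition cw_pr (A : cw R 3) : cw R 2 := SigSub (mem_set (pr_cc_cw (set_valP A))).

Lemma cw_prE (A : cw R 3) : val (cw_pr A) = pr @` val A :> set _.
Proof. by []. Qed.

Lemma hausdorff_dist_pr_le (A B : cc R 3) :
  hausdorff_dist (pr_cc A) (pr_cc B) <= hausdorff_dist A B.
Proof.
have e C D : excess (pr_cc C) (pr_cc D) <= excess C D.
  apply: excess_le => _ [c Cc <-].
  have [d Dd dcd] := dist_to_set_attained D c.
  apply: le_trans (dist_to_set_le_excess D Cc); rewrite dcd.
  by apply: le_trans (edist_pr_le c d); apply: dist_to_set_le; exists d.
by rewrite /hausdorff_dist ge_max !le_max !e ?orbT.
Qed.

Lemma pr_cc_continuous : continuous pr_cc.
Proof.
move=> A U /nbhs_ballP [e e0 eU]; apply/nbhs_ballP; exists e => //= B AB.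
apply: eU; rewrite ballEmdist/=; apply: le_lt_trans (hausdorff_dist_pr_le A B) _.
by move: AB; rewrite ballEmdist.
Qed.

Lemma cw_pr_continuous : continuous cw_pr.
Proof.
apply: continuous_comp_initial => A.
apply: (@continuous_comp _ _ _ set_val pr_cc); last exact: pr_cc_continuous.
exact: initial_continuous.
Qed.

HB.instance Definition _ := isContinuous.Build _ _ cw_pr cw_pr_continuous.

End Projection.

(* Main.v *)
From HB Require Import structures.
From mathcomp Require Import all_boot all_order all_algebra ring lra.
From mathcomp Require Import all_classical all_reals all_analysis.
Require Import Defs.

(** Soft maps lift convergent sequences: testing 0-softness on the one-point
    compactification of [nat], with the point at infinity as closed subset, shows
    that whenever [B n] converges to the projection of [A], the [B n] are
    projections of bodies converging to [A].  The projection of bodies of constant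
    width violates this, because corners of a planar shadow make the body above
    it flat.

    Flatness: let [K] have constant width [d], and let two points of its shadow
    be at distance exactly [d].  Points of [K] above them are at distance at most
    [d], so they have the same height ([eq_height]).  If the shadow
    contains a regular polygon with an odd number of vertices and longest
    diagonal [d], then the longest diagonals link all its vertices, and [K]
    contains a horizontal copy of the polygon ([polygon_lift_flat]).

    Take for [A] a body of constant width 2 that contains the curve of height
    [|x|] above the unit circle ([exists_bent_body]); its shadow is the unit
    disc.  Take for [B n] a body containing the regular polygon with [2n + 3]
    vertices inscribed in the unit circle, of constant width the longest diagonal
    (a Reuleaux polygon); these converge to the disc ([polygon_bodies_cvg]).
    Lifts [L n] of the [B n] that converge to [A] would carry points of equal
    height close to the points of [A] above (1, 0) and (0, 1), whose heights
    are 1 and 0 ([bent_body_not_flat]).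

    All these bodies come from one classical theorem of Meissner: a nonempty set
    of diameter at most [d] lies in a body of constant width [d]
    ([exists_cwd]).  A maximal set of diameter [d], given by Zorn's lemma, is an
    intersection of balls of radius [d], hence compact and convex, and the lemma
    [spindle_pokes_out] shows that it has constant width. *)

Set Implicit Arguments.
Unset Strict Implicit.
Unset Printing Implicit Defensive.

Import Order.TTheory GRing.Theory Num.Theory.
Import numFieldNormedType.Exports.

Local Open Scope classical_set_scope.
Local Open Scope ring_scope.

(** * Euclidean geometry *)

Section EuclideanFacts.
Context {R : realType} {n : nat}.
Implicit Types u v w x y z : 'rV[R]_n.

Lemma dotNl u v : dot (- u) v = - dot u v.
Proof. by rewrite -scaleN1r dotZl mulN1r. Qed.

Lemma dotNr u v : dot u (- v) = - dot u v.
Proof. by rewrite dotC dotNl dotC. Qed.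

Definition dotE := (@dotDl R n, @dotDr R n, dotNl, dotNr, @dotZl R n, @dotZr R n).

Lemma sqr_enorm u : enorm u ^+ 2 = dot u u.
Proof. by rewrite sqr_sqrtr// dot_ge0. Qed.

Lemma enorm_leE u d : 0 <= d -> (enorm u <= d) = (dot u u <= d ^+ 2).
Proof. by move=> d0; rewrite -sqr_enorm ler_sqr ?nnegrE// enorm_ge0. Qed.

Lemma enormZ a u : enorm (a *: u) = `|a| * enorm u.
Proof.
by rewrite /enorm !dotE mulrA -expr2 sqrtrM ?sqr_ge0// sqrtr_sqr.
Qed.

Lemma dot_le_enorm u v : `|dot u v| <= enorm u * enorm v.
Proof.
rewrite -ler_sqr ?nnegrE ?mulr_ge0 ?enorm_ge0// exprMn !sqr_enorm.
by rewrite real_normK ?num_real// cauchy_schwarz.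
Qed.

Lemma coord_le_enorm u i : `|u 0 i| <= enorm u.
Proof.
rewrite -ler_sqr ?nnegrE ?enorm_ge0// sqr_enorm real_normK ?num_real//.
rewrite /dot (bigD1 i)//= -expr2 lerDl.
by apply: sumr_ge0 => j _; rewrite -expr2 sqr_ge0.
Qed.

End EuclideanFacts.

(** * Diametrically complete sets have constant width *)

Section Completion.
Context {R : realType} {n : nat}.
Implicit Types u v w x y z : 'rV[R]_n.
Implicit Types S V : set 'rV[R]_n.

Definition diam_le (d : R) S := forall x y, S x -> S y -> edist x y <= d.

(** Equivalent to being maximal, for inclusion, among the sets of diameter at
    most [d]. *)
Definition diam_complete (d : R) S :=
  diam_le d S /\ forall w, (forall y, S y -> edist w y <= d) -> S w.

(** Zorn's lemma is applied to the sets [S] such that [V `|` S] has diameter at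
    most [d], rather than to those containing [V], so that the union of the empty
    chain qualifies. *)
Lemma exists_diam_complete d V : 0 <= d -> diam_le d V ->
  exists2 S, V `<=` S & diam_complete d S.
Proof.
move=> d0 Vd.
have [F FP Ftot|S [Sd Smax]] :=
    @Zorn_bigcup _ [set S : set 'rV[R]_n | diam_le d (V `|` S)].
  have aux x y : (V `|` \bigcup_(X in F) X) x -> (V `|` \bigcup_(X in F) X) y ->
      (V x /\ V y) \/ exists2 X, F X & (V `|` X) x /\ (V `|` X) y.
    move=> [Vx|[X FX Xx]] [Vy|[Y FY Yy]]; [by left|right..].
    - by exists Y => //; split; [left|right].
    - by exists X => //; split; [right|left].
    - have [XY|YX] := Ftot _ _ FX FY.
      + by exists Y => //; split; right => //; exact: XY.
      + by exists X => //; split; right => //; exact: YX.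
  by move=> x y Sx Sy; have [[Vx Vy]|[X FX [Xx Xy]]] := aux _ _ Sx Sy;
    [exact: Vd|exact: (FP X FX)].
exists (V `|` S) => [x Vx|]; [by left|split=> // w wS].
apply: contrapT => /not_orP[_ nSw]; apply: (Smax (S `|` [set w])).
  split=> [x Sx|/(_ w)]; first by left.
  by move=> h; apply/nSw/h; right.
have aux x : (V `|` (S `|` [set w])) x -> (V `|` S) x \/ x = w.
  by move=> [|[|]]; [left; left|left; right|right].
move=> x y /aux[Sx|->] /aux[Sy|->]; first exact: Sd.
- by rewrite edistC wS.
- exact: wS.
- by rewrite edistxx.
Qed.

(** A complete set is the intersection of the balls of radius [d] centered at its
    points; this gives closedness, compactness and convexity. *)
Lemma diam_complete_closed d S : diam_complete d S -> closed S.
Proof.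
move=> [Sd Sc].
have -> : S = \bigcap_(y in S) [set w | edist y w <= d].
  apply/seteqP; split=> [x Sx y Sy|w wS]; first exact: Sd.
  by apply: Sc => y Sy; rewrite edistC; exact: wS.
apply: closed_bigI => y _.
apply: (closed_comp (D := [set r | r <= d])); last exact: closed_le.
by move=> w _; exact: edist_continuous.
Qed.

Lemma diam_complete_compact d S : diam_complete d S -> compact S.
Proof.
move=> Sc; apply: bounded_closed_compact; last exact: diam_complete_closed Sc.
have [->|/set0P[x Sx]] := eqVneq S set0.
  by exists 0; split; [exact: num_real|move=> M _ y].
exists (enorm x + d); split; first exact: num_real.
move=> M dM y Sy.
have yM : enorm y <= M.
  apply: le_trans (ltW dM).
  rewrite -[y](subrK x) addrC (le_trans (enormD _ _))// lerD2l.
  exact: Sc.1.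
have M0 : 0 <= M by exact: le_trans (enorm_ge0 y) yM.
rewrite /Num.norm/= mx_normrE; apply/bigmax_leP; split=> // -[i j] _.
by rewrite ord1; exact: le_trans (coord_le_enorm _ _) yM.
Qed.

Lemma diam_complete_convex d S : diam_complete d S -> convex_set S.
Proof.
move=> [Sd Sc] x y t /set_mem Sx /set_mem Sy; apply/mem_set.
apply: Sc => z Sz.
have t0 : 0 <= t%:num by [].
have t1 : 0 <= 1 - t%:num by rewrite subr_ge0.
have -> : edist (conv t (x : convex_lmodType _) (y : convex_lmodType _)) z =
    enorm (t%:num *: (x - z) + (1 - t%:num) *: (y - z)).
  congr enorm; apply/rowP => i; by rewrite !mxE /unstable.onem; ring.
apply: le_trans (enormD _ _) _; rewrite !enormZ !ger0_norm//.
have -> : d = t%:num * d + (1 - t%:num) * d by ring.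
by rewrite lerD// ler_wpM2l// ?Sd.
Qed.

(** Let [H] be the hyperplane through [x] orthogonal to [u], let [z] lie below
    [H] but outside the ball of radius [d] that touches [H] at [x] from below.
    The intersection of all balls of radius [d] containing [x] and [z] (their
    spindle) has an arc of radius [d] from [x] to [z] on its boundary, and this
    arc starts by rising above [H]: the point [w] is found near its beginning. *)
Lemma spindle_pokes_out d x z u : 0 < d -> enorm u = 1 ->
    dot (z - x) u <= 0 -> d < edist z (x - d *: u) ->
  exists2 w, 0 < dot (w - x) u &
    forall y, edist y x <= d -> edist y z <= d -> edist y w <= d.
Proof.
move=> d0 u1 vu zd; have [v vE] : exists v, z - x = v by exists (z - x).
rewrite vE in vu *; have [s sE] : exists s, dot v u = s by exists (dot v u).
rewrite sE in vu.
have uu : dot u u = 1 by rewrite -sqr_enorm u1 expr1n.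
pose g := dot v v + 2 * d * s.
have g0 : 0 < g.
  have := zd; rewrite ltNge enorm_leE ?(ltW d0)// -ltNge.
  have -> : z - (x - d *: u) = v + d *: u.
    by rewrite -vE opprB addrCA addrC.
  by rewrite !dotE uu (dotC u v) sE /g; nra.
(* [q] is [z - x] tilted upwards so as to have the small slope [e] above [H];
   the bound on [edist y w] is then negative at first order in [a]. *)
pose e := g / (4 * d); have [q qE] : exists q, v + (e - s) *: u = q by eexists.
have C0 : 0 <= dot q q := dot_ge0 q.
have de : 4 * d * e = g by rewrite /e; field; rewrite gt_eqF.
have e0 : 0 < e by rewrite divr_gt0// mulr_gt0.
have es0 : 0 <= e - s by lra.
pose a := g / (2 * (dot q q + g)).
have qg : 0 < dot q q + g by lra.
have a0 : 0 < a by rewrite divr_gt0// mulr_gt0.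
have aE : a * (2 * (dot q q + g)) = g by rewrite /a; field; rewrite gt_eqF.
exists (x + a *: q).
  rewrite addrC addKr -qE !dotE uu sE.
  by have := mulr_gt0 a0 e0; lra.
move=> y; rewrite !enorm_leE ?(ltW d0)//.
have -> : y - z = (y - x) - v by rewrite -vE opprB addrA subrK.
have -> : y - (x + a *: q) = (y - x) - a *: q by rewrite opprD addrA.
move: (y - x) => p p1.
have pu : - d <= dot p u.
  have := dot_le_enorm p u; rewrite u1 mulr1 => h.
  have pd : enorm p <= d by rewrite enorm_leE ?(ltW d0).
  by move: (le_trans h pd); rewrite ler_norml => /andP[].
rewrite !dotE (dotC v p) (dotC q p) => p2.
have pq : dot p q = dot p v + (e - s) * dot p u by rewrite -qE !dotE.
have pu' : 0 <= (e - s) * (d + dot p u) by rewrite mulr_ge0//; lra.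
rewrite pq; move: p1 p2 C0 aE qg pu' {pq}.
move: (dot p p) (dot p v) (dot p u) (dot q q) => P PV PU C p1 p2 C0 aE qg pu'.
have a1 : a <= 1 by nra.
have aC : a * C <= g / 2 by nra.
have h1 : 0 <= (1 - a) * (d ^+ 2 - P) by rewrite mulr_ge0//; lra.
have h2 : 0 <= a * (d ^+ 2 - (P - 2 * PV + dot v v)) by rewrite mulr_ge0//; lra.
have h3 : 0 <= a * ((e - s) * (d + PU)) by rewrite mulr_ge0// ltW.
have h4 : 0 <= a * (g / 2 - a * C) by rewrite mulr_ge0//; lra.
have h5 : a * (4 * d * e) = a * g by rewrite de.
rewrite /g in h4 h5; nra.
Qed.

(** Let [x] be a point of [K] where the hyperplane orthogonal to [u] supports [K].
    By the spindle lemma no point of [K] is at distance more than [d] from the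
    opposite point [x - d *: u], as otherwise [K] would cross that hyperplane;
    completeness puts [x - d *: u] in [K], so the width is at least [d]. *)
Lemma diam_complete_cwd d (K : cc R n) : 0 < d -> diam_complete d K -> cwd d K.
Proof.
move=> d0 [Kd Kc] u u1; rewrite /width.
have [x Kx [-> xmax]] := support_max K u.
have [x' Kx' [-> xmax']] := support_max K (- u).
have uu : dot u u = 1 by rewrite -sqr_enorm u1 expr1n.
apply/eqP; rewrite eq_le; apply/andP; split.
  rewrite dotNr -dotNl -dotDl.
  have := dot_le_enorm (x - x') u; rewrite u1 mulr1 => h.
  exact: le_trans (ler_norm _) (le_trans h (Kd _ _ Kx Kx')).
have Kxd : body K (x - d *: u).
  apply: (Kc) => z Kz; rewrite edistC leNgt; apply/negP => zd.
  have zx : dot (z - x) u <= 0 by rewrite !dotE subr_le0; exact: xmax.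
  have [w + wd] := spindle_pokes_out d0 u1 zx zd.
  rewrite !dotE subr_gt0 ltNge xmax//; apply: Kc => y Ky.
  by rewrite edistC; apply: wd; exact: Kd.
by have := xmax' _ Kxd; rewrite !dotE uu; lra.
Qed.

Lemma exists_cwd d V : 0 < d -> V !=set0 -> diam_le d V ->
  exists2 K : cc R n, V `<=` K & cwd d K.
Proof.
move=> d0 [v Vv] Vd; have [S VS Sc] := exists_diam_complete (ltW d0) Vd.
have S0 : S !=set0 by exists v; exact: VS.
exists (CC S0 (diam_complete_compact Sc) (diam_complete_convex Sc)) => //.
exact: diam_complete_cwd.
Qed.

Lemma cwd_diam_le d (K : cc R n) : 0 <= d -> cwd d K -> diam_le d K.
Proof.
move=> d0 Kd x y Kx Ky; have [->|xy] := eqVneq x y; first by rewrite edistxx.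
have e0 : 0 < edist x y.
  rewrite lt_neqAle edist_ge0 andbT eq_sym; apply: contra_neq xy.
  exact: edist_eq0.
pose u := (edist x y)^-1 *: (x - y).
have u1 : enorm u = 1.
  by rewrite enormZ ger0_norm ?invr_ge0 ?ltW// mulVf ?gt_eqF.
have := Kd u u1; rewrite /width.
have [p _ [-> pmax]] := support_max K u.
have [q _ [-> qmax]] := support_max K (- u) => <-.
apply: le_trans (lerD (pmax _ Kx) (qmax _ Ky)).
rewrite dotNr -dotNl -dotDl /u dotZr -sqr_enorm expr2 mulrA.
by rewrite mulVf ?mul1r// gt_eqF.
Qed.

End Completion.

(** * A convergent sequence as a test space *)

Section ConvergentSequence.
Local Open Scope nat_scope.

Notation natoo := (one_point_compactification nat).

Lemma compact_nat_bounded (C : set nat) :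
  compact C -> exists N, forall n, C n -> n < N.
Proof.
rewrite compact_cover => /(_ _ setT (fun n => `I_n)) [|n _|D _ CD].
- by move=> n _; exact: discrete_open.
- by exists n.+1 => //=.
- exists (\max_(n <- finmap.enum_fset D) n) => n /CD[N /= DN nN].
  by apply: leq_trans nN _; apply: (@leq_bigmax_seq _ _ _ id).
Qed.

Lemma natoo_hausdorff : hausdorff_space natoo.
Proof.
apply: one_point_compactification_hausdorff; last exact: discrete_hausdorff.
move=> n _; exists [set n].
  by apply: (@filterS _ (nbhs n) _ [set n]) => [m mn _|]; last exact: discrete_set1.
by split; [exact: compact_set1|exact: discrete_closed].
Qed.

Lemma nbhs_natoo (U : set natoo) :
  nbhs (None : natoo) U <-> U None /\ \forall n \near \oo, U (Some n).
Proof.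
split=> [[C [Ccpt _] CU]|[UN [N _ NU]]].
  split; first by apply: CU; right.
  have [N CN] := compact_nat_bounded Ccpt.
  exists N => // n /= Nn; apply: CU; left; exists n => //.
  by move=> /CN; rewrite ltnNge Nn.
exists `I_N.
  split; last exact: discrete_closed.
  exact: finite_compact.
move=> _ [[n /= /negP nN <-]|->//]; apply: NU => /=.
by rewrite leqNgt.
Qed.

Lemma natoo_continuous (T : topologicalType) (f : natoo -> T) :
  f (Some n) @[n --> \oo] --> f None -> continuous f.
Proof.
move=> fN [n|] U Uf.
  have h := one_point_compactification_some_nbhs _ _ (discrete_set1 n).
  apply: (@filterS _ (nbhs (Some n : natoo)) _ _ (f @^-1` U) _ h) => _ [_ -> <-].
  exact: nbhs_singleton.
apply/nbhs_natoo; split; [exact: nbhs_singleton|exact: fN].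
Qed.

Lemma natoo_open_some (n : nat) : open [set (Some n : natoo)].
Proof.
rewrite -image_set1; apply: one_point_compactification_open_some.
exact: discrete_open.
Qed.

(** The member of the cover that contains the point at infinity leaves out
    finitely many integers, which are covered by singletons.  This one refinement
    yields both paracompactness and dimension zero. *)
Lemma natoo_disjoint_refinement (F : set (set natoo)) : open_cover F ->
  exists G, [/\ finite_set G, open_cover G, refines G F &
    forall z U V, G U -> G V -> U z -> V z -> U = V].
Proof.
move=> [Fo Fcov].
have cov z : exists2 U, F U & U z.
  by have [U FU Uz] : (\bigcup_(U in F) U) z by [rewrite Fcov]; exists U.
have [U FU UN] := cov None.
have [_ [N _ NU]] : U None /\ \forall n \near \oo, U (Some n).
  by apply/nbhs_natoo; apply: open_nbhs_nbhs; split => //; exact: Fo.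
exists (U |` [set [set Some n] | n in `I_N `&` [set n | ~ U (Some n)]]); split.
- rewrite finite_setU; split => //; apply: finite_image.
  exact: finite_setIl.
- split=> [V [->|[n _ <-]]|]; [exact: Fo|exact: natoo_open_some|].
  apply/seteqP; split=> // z _.
  have [Uz|nUz] := pselect (U z); first by exists U; [left|].
  case: z => [n|//] in nUz *; exists [set Some n] => //; right; exists n => //.
  by split=> //=; rewrite ltnNge; apply/negP => /NU.
- move=> V [->|[n _ <-]]; first by exists U.
  by have [W FW Wn] := cov (Some n); exists W => // _ ->.
- move=> z V W [->|[n [_ nU] <-]] [->|[m [_ mU] <-]] //=.
  + by move=> Uz zm; rewrite zm in Uz.
  + by move=> zn; rewrite zn.
  + by move=> -> [->].
Qed.

Lemma natoo_paracompact : paracompact natoo.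
Proof.
split=> [|F Fcov]; first exact: natoo_hausdorff.
have [G [Gfin Gcov GF _]] := natoo_disjoint_refinement Fcov.
exists G; split=> // z; exists setT; first exact: filterT.
by apply: sub_finite_set Gfin => V [].
Qed.

Lemma natoo_covering_dim0 : covering_dim_le natoo 0.
Proof.
move=> F _ Fcov; have [G [Gfin Gcov GF Gdisj]] := natoo_disjoint_refinement Fcov.
exists G; split=> // z.
have [U [GU Uz]] : exists U, G U /\ U z.
  by have [U GU Uz] : (\bigcup_(U in G) U) z by [rewrite Gcov.2]; exists U.
rewrite -(card_le_eqr (@card_set1 _ U)); apply: subset_card_le.
by move=> V [GV Vz]; exact: Gdisj Vz Uz.
Qed.

End ConvergentSequence.

(** * Regular polygons with an odd number of vertices *)

Section OddPolygon.
Context {R : realType}.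
Implicit Types (s t : R) (k : nat) (j : int).

Definition cis t : 'rV[R]_2 := \row_i if i == ord0 then cos t else sin t.

Lemma dot_cis s t : dot (cis s) (cis t) = cos (s - t).
Proof. by rewrite /dot !big_ord_recl big_ord0 !mxE /= addr0 cosB. Qed.

Lemma enorm_cis t : enorm (cis t) = 1.
Proof. by rewrite /enorm dot_cis subrr cos0 sqrtr1. Qed.

Lemma edist_cis s t : edist (cis s) (cis t) = Num.sqrt (2 - 2 * cos (s - t)).
Proof.
rewrite /edist /enorm !dotE (dotC (cis t) (cis s)) !dot_cis !subrr cos0.
by congr Num.sqrt; ring.
Qed.

Lemma unit_cis (u : 'rV[R]_2) : enorm u = 1 ->
  exists2 t, `|t| <= pi & u = cis t.
Proof.
move=> u1; have : dot u u = 1 by rewrite -sqr_enorm u1 expr1n.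
rewrite /dot !big_ord_recl big_ord0 addr0; set i1 := lift _ _.
set x := u 0 ord0; set y := u 0 i1 => xy.
have x1 : -1 <= x <= 1 by apply/andP; split; nra.
have cx : cos (acos x) = x by rewrite acosK// in_itv.
have sx : sin (acos x) = `|y|.
  have y2 : 1 - x ^+ 2 = y ^+ 2 by rewrite -xy; ring.
  by rewrite sin_acos// y2 sqrtr_sqr.
have ax : `|acos x| <= pi by rewrite ger0_norm ?acos_lepi ?acos_ge0.
have uE t : cos t = x -> sin t = y -> u = cis t.
  move=> ct st; apply/rowP => i; rewrite mxE; case: eqP => [->|i0].
    by rewrite ct.
  suff -> : i = i1 by rewrite st.
  by case: i i0 => [[|[|//]] ilt] i0; [case: i0|]; exact: val_inj.
have [y0|y0] := leP 0 y.
  by exists (acos x) => //; apply: uE => //; rewrite sx ger0_norm.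
exists (- acos x); first by rewrite normrN.
by apply: uE; [rewrite cosN|rewrite sinN sx ltr0_norm ?opprK].
Qed.

Lemma le_cos s t : 0 <= s -> s <= t -> t <= pi -> cos t <= cos s.
Proof.
move=> s0 st tp; rewrite leNgt ltr_cos; first by rewrite -leNgt.
- by rewrite in_itv/= tp (le_trans s0 st).
- by rewrite in_itv/= s0 (le_trans st tp).
Qed.

(** The angle between consecutive vertices of the regular polygon with [2k + 1]
    vertices. *)
Definition step k : R := (pi *+ 2) / k.*2.+1%:R.

Lemma stepE k : (2 * k%:R + 1) * step k = 2 * pi.
Proof.
have -> : 2 * k%:R + 1 = k.*2.+1%:R :> R.
  by rewrite -(addn1 k.*2) natrD -(muln2 k) natrM mulrC.
by rewrite mulrC divfK ?pnatr_eq0// mulr_natl.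
Qed.

Lemma step_gt0 k : 0 < step k.
Proof. by rewrite divr_gt0// mulrn_wgt0// pi_gt0. Qed.

Lemma step_halfE k : k%:R * step k = pi - step k / 2.
Proof. by have := stepE k; lra. Qed.

Definition vertex k j := cis (j%:~R * step k).

(** Numbering the vertices from [-k] to [k] makes differences of indices at most
    [2k], so no reduction modulo [2k + 1] is ever needed. *)
Definition polygon k : set 'rV[R]_2 :=
  [set vertex k j | j in [set j | (`|j| <= k)%N]].

(** The longest diagonal subtends the angle [pi - step k / 2], so this is
    [2 * cos (step k / 4)]. *)
Definition polygon_diam k := Num.sqrt (2 + 2 * cos (step k / 2)).

Lemma edist_vertex k i j :
  edist (vertex k i) (vertex k j) = Num.sqrt (2 - 2 * cos (`|i - j|%N%:R * step k)).
Proof.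
rewrite edist_cis -mulrBl -intrB -cos_norm normrM (gtr0_norm (step_gt0 k)).
by rewrite -intr_norm.
Qed.

Lemma cos_half_turn k : cos (k%:R * step k) = - cos (step k / 2).
Proof. by rewrite step_halfE cosB cospi sinpi; ring. Qed.

Lemma cos_half_turnS k : cos (k.+1%:R * step k) = - cos (step k / 2).
Proof.
have -> : k.+1%:R * step k = pi + step k / 2.
  by rewrite -(addn1 _) natrD mulrDl step_halfE; lra.
by rewrite cosD cospi sinpi; ring.
Qed.

(** No multiple of [step k] is closer to a half-turn than [k] or [k + 1] steps,
    each of which misses it by [step k / 2]. *)
Lemma cos_step_ge k m : (m <= k.*2)%N -> - cos (step k / 2) <= cos (m%:R * step k).
Proof.
have sk := step_gt0 k; have hk := step_halfE k.
have small l : (l <= k)%N -> - cos (step k / 2) <= cos (l%:R * step k).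
  move=> lk; rewrite -cos_half_turn; apply: le_cos.
  - by rewrite mulr_ge0// ltW.
  - by rewrite ler_wpM2r ?(ltW sk)// ler_nat.
  - by rewrite hk; lra.
move=> mk; have [|km] := leqP m k; first exact: small.
have mE : m%:R * step k = - ((k.*2.+1 - m)%:R * step k) + pi *+ 2.
  rewrite natrB 1?ltnW// -(addn1 k.*2) natrD -(muln2 k) natrM -mulr_natl.
  by have := stepE k; lra.
rewrite mE cosD2pi cosN small//.
by rewrite leq_subLR -addnn -addSn leq_add2r.
Qed.

Lemma polygon_diam_le k : diam_le (polygon_diam k) (polygon k).
Proof.
move=> _ _ [i /= ik <-] [j /= jk <-]; rewrite edist_vertex ler_wsqrtr//.
rewrite lerD2l -mulrN ler_pM2l// lerNl cos_step_ge//.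
by rewrite -addnn (leq_trans (leqD_dist i 0 j))// ?subr0 ?sub0r ?abszN leq_add.
Qed.

Lemma polygon_diam_le2 k : polygon_diam k <= 2.
Proof.
rewrite -[leRHS]ger0_norm// -sqrtr_sqr ler_wsqrtr//.
by have := cos_le1 (step k / 2); lra.
Qed.

Lemma polygon_diam_gt0 k : (0 < k)%N -> 0 < polygon_diam k.
Proof.
move=> k0; have : 0 < cos (step k / 2).
  apply: cos_gt0_pihalf; have := stepE k; have := step_gt0 k.
  have : 1 <= k%:R :> R by rewrite ler1n.
  by move=> k1 sk hk; apply/andP; split; nra.
by move=> c0; rewrite sqrtr_gt0; lra.
Qed.

(** The two longest diagonals from the vertex [n - k] end at consecutive vertices
    [n] and [n + 1]. *)
Lemma edist_vertex_opposite k (n : nat) :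
  edist (vertex k n) (vertex k (n%:Z - k%:Z)) = polygon_diam k.
Proof.
rewrite edist_vertex.
have -> : n%:Z - (n%:Z - k%:Z) = k%:Z by ring.
by rewrite cos_half_turn /polygon_diam mulrN opprK.
Qed.

Lemma edist_vertex_oppositeS k (n : nat) :
  edist (vertex k n.+1) (vertex k (n%:Z - k%:Z)) = polygon_diam k.
Proof.
rewrite edist_vertex.
have -> : n.+1%:Z - (n%:Z - k%:Z) = k.+1%:Z.
  by rewrite -(addn1 n) -(addn1 k) !PoszD; ring.
by rewrite cos_half_turnS /polygon_diam mulrN opprK.
Qed.

Lemma step_le_pi k : (0 < k)%N -> step k <= pi.
Proof.
move=> k0; have : 1 <= k%:R :> R by rewrite ler1n.
by have := stepE k; have := step_gt0 k; nra.
Qed.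

Definition mesh k : R := edist (cis (step k)) (cis 0).

Lemma near_vertex k t : (0 < k)%N -> 0 <= t <= pi -> exists2 n, (n <= k)%N &
  edist (cis t) (vertex k n) <= mesh k.
Proof.
move=> k0 /andP[t0 tp]; have sk := step_gt0 k.
have /truncn_itv : 0 <= t / step k by rewrite divr_ge0// ltW.
set n := Num.truncn _; rewrite ler_pdivlMr// ltr_pdivrMr// => /andP[nt tn].
have nk : (n <= k)%N.
  rewrite -ltnS -(ltr_nat R) -(ltr_pM2r sk).
  by apply: le_lt_trans nt _; rewrite -(addn1 _) natrD mulrDl step_halfE; lra.
exists n => //; rewrite /mesh !edist_cis ler_wsqrtr// subr0 lerD2l lerN2.
rewrite ler_pM2l// -[(n : int)%:~R]/(n%:R).
apply: le_cos; [lra| |exact: step_le_pi].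
by move: tn; rewrite -addn1 natrD mulrDl; lra.
Qed.

Lemma polygon_dense k (u : 'rV[R]_2) : (0 < k)%N -> enorm u = 1 ->
  exists2 v, polygon k v & edist u v <= mesh k.
Proof.
move=> k0 /unit_cis[t tpi ->].
have [n nk] : exists2 n, (n <= k)%N & edist (cis `|t|) (vertex k n) <= mesh k.
  by apply: near_vertex => //; rewrite normr_ge0.
have [t0 nt|t0 nt] := ger0P t.
  by exists (vertex k n) => //; exists n.
exists (vertex k (- n%:Z)); first by exists (- n%:Z) => //=; rewrite abszN.
move: nt; rewrite /vertex !edist_cis.
have -> : t - (- n%:Z)%:~R * step k = - (- t - n%:~R * step k).
  by rewrite rmorphN; ring.
by rewrite cosN.
Qed.

Lemma step_cvg0 : step k @[k --> \oo] --> (0 : R).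
Proof.
apply: (@squeeze_cvgr _ _ _ _ (cst 0) (fun k => (pi *+ 2) * harmonic k)).
- near=> k; rewrite /= (ltW (step_gt0 k))/= /step /harmonic/= ler_wpM2l//.
    by rewrite mulrn_wge0// pi_ge0.
  by rewrite lef_pV2 ?posrE// ler_nat ltnS -addnn leq_addr.
- exact: cvg_cst.
- by rewrite -[X in _ --> X](mulr0 (pi *+ 2)); apply: cvgMr; exact: cvg_harmonic.
Unshelve. all: by end_near. Qed.

Lemma mesh_cvg0 : mesh k @[k --> \oo] --> (0 : R).
Proof.
pose g t : R := Num.sqrt (2 - 2 * cos t).
have -> : mesh = g \o step.
  by apply/funext => k; rewrite /mesh edist_cis subr0.
have <- : g 0 = 0 by rewrite /g cos0 mulr1 subrr sqrtr0.
have gc : {for 0, continuous g}.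
  apply: (@continuous_comp _ _ _ (fun t : R => 2 - 2 * cos t)).
    apply: continuousB; first exact: cvg_cst.
    by apply: continuousM; [exact: cvg_cst|exact: continuous_cos].
  exact: sqrt_continuous.
by move=> U /gc /step_cvg0.
Qed.

End OddPolygon.

(** * Bodies close to the unit disc *)

Section NearDisc.
Context {R : realType}.

Lemma polar (x : 'rV[R]_2) : exists2 w, enorm w = 1 & x = enorm x *: w.
Proof.
have [->|x0] := eqVneq x 0.
  exists (cis 0); first exact: enorm_cis.
  by rewrite /enorm -(scale0r 0) dotZl mul0r sqrtr0 !scale0r.
have nx0 : enorm x != 0.
  apply: contra_neq x0 => nx; apply: dot_eq0.
  by rewrite -sqr_enorm nx expr0n.
exists ((enorm x)^-1 *: x); last by rewrite scalerA divff// scale1r.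
by rewrite enormZ ger0_norm ?invr_ge0 ?enorm_ge0// mulVf.
Qed.

Lemma cc_segment n (K : cc R n) x y t : body K x -> body K y ->
  0 <= t <= 1 -> body K (t *: x + (1 - t) *: y).
Proof.
move=> Kx Ky /andP[t0 t1].
have := @body_convex _ _ K x y (Itv01 t0 t1) (mem_set Kx) (mem_set Ky).
by move=> /set_mem.
Qed.

Lemma unit_ball_sub (K : cc R 2) (x : 'rV[R]_2) : @sphere R 2 `<=` body K ->
  enorm x <= 1 -> body K x.
Proof.
move=> SK x1; have [w w1 ->] := polar x.
have -> : enorm x *: w =
    ((1 + enorm x) / 2) *: w + (1 - (1 + enorm x) / 2) *: (- w).
  by rewrite scalerN -scalerBl; congr (_ *: _); field.
apply: cc_segment; [exact: SK|by apply: SK; rewrite /sphere/= enormN|].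
by have := enorm_ge0 x; lra.
Qed.

(** A body of diameter at most 2 containing the unit circle is the unit disc.  A
    body [L] of diameter at most 2 with points [e]-close to every point of the
    circle is [e]-close to the disc in both senses: each point of the disc lies on
    a diameter, whose endpoints are close to [L]; and a point of [L] at norm
    [r > 1] is at distance at least [r + 1 - e] from the point of [L] close to
    its antipode, so that [r <= 1 + e]. *)
Lemma hausdorff_dist_disc_le (K L : cc R 2) e :
    @sphere R 2 `<=` body K -> diam_le 2 K -> diam_le 2 L ->
    (forall u, sphere u -> exists2 v, body L v & edist u v <= e) ->
  hausdorff_dist K L <= e.
Proof.
move=> SK K2 L2 Ldense.
have e0 : 0 <= e.
  by have [v _] := Ldense _ (enorm_cis 0); apply: le_trans; exact: edist_ge0.
rewrite /hausdorff_dist ge_max; apply/andP; split; apply: excess_le => x.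
- move=> Kx; have [w w1 xw] := polar x.
  have w1' : sphere (- w) by rewrite /sphere/= enormN.
  have x1 : enorm x <= 1.
    have := K2 _ _ Kx (SK _ w1'); rewrite /edist opprK {1}xw.
    rewrite -[X in _ + X]scale1r -scalerDl enormZ w1 mulr1.
    by rewrite ger0_norm ?addr_ge0 ?enorm_ge0//; lra.
  have [v Lv wv] := Ldense _ w1; have [v' Lv' wv'] := Ldense _ w1'.
  pose t := (1 + enorm x) / 2.
  have t0 : 0 <= t by rewrite /t; have := enorm_ge0 x; lra.
  have t1 : 0 <= 1 - t by rewrite /t; lra.
  have Lt : body L (t *: v + (1 - t) *: v').
    by apply: cc_segment => //; rewrite t0 -subr_ge0.
  apply: le_trans (dist_to_set_le _ Lt) _.
  have -> : edist x (t *: v + (1 - t) *: v') =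
      enorm (t *: (w - v) + (1 - t) *: (- w - v')).
    congr enorm; rewrite {1}xw.
    by apply/rowP => i; rewrite !mxE /t; field.
  apply: le_trans (enormD _ _) _; rewrite !enormZ !ger0_norm//.
  have -> : e = t * e + (1 - t) * e by ring.
  by apply: lerD; exact: ler_wpM2l.
- move=> Lx; have [x1|x1] := leP (enorm x) 1.
    apply: le_trans e0; rewrite -(edistxx x); apply: dist_to_set_le.
    exact: unit_ball_sub.
  have [w w1 xw] := polar x.
  apply: le_trans (dist_to_set_le _ (SK _ w1)) _.
  have w1' : sphere (- w) by rewrite /sphere/= enormN.
  have [v Lv wv] := Ldense _ w1'.
  have := edist_triangle v x (- w); rewrite (edistC v).
  have := L2 _ _ Lx Lv.
  have -> : edist x (- w) = enorm x + 1.
    rewrite /edist opprK {1}xw -[X in _ + X]scale1r -scalerDl enormZ w1 mulr1.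
    by rewrite ger0_norm ?addr_ge0 ?enorm_ge0.
  have -> : edist x w = enorm x - 1.
    rewrite /edist {1}xw -[X in _ - X]scale1r -scalerBl enormZ w1 mulr1.
    by rewrite ger0_norm// subr_ge0 ltW.
  lra.
Qed.

End NearDisc.

(** * Heights over the vertices of an odd polygon *)

Section Heights.
Context {R : realType}.
Implicit Types (x y : 'rV[R]_3) (K : cc R 3).

Definition height x : R := x 0 ord_max.

Lemma sqr_edist3 x y :
  edist x y ^+ 2 = edist (pr x) (pr y) ^+ 2 + (height x - height y) ^+ 2.
Proof. by rewrite !sqr_enorm dot3 prB !mxE -expr2. Qed.

Lemma height_dist_le x y : `|height x - height y| <= edist x y.
Proof.
rewrite -ler_sqr ?nnegrE ?edist_ge0// real_normK ?num_real// sqr_edist3.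
by rewrite lerDr sqr_ge0.
Qed.

Lemma cwd_pr d K : cwd d K -> cwd d (pr_cc K).
Proof.
move=> Kd u u1; rewrite /width !support_pr.
have -> : embed (- u) = - embed u.
  by rewrite [RHS](@opp_row_mx _ 1 2 1) oppr0.
by apply: Kd; rewrite /sphere/= /enorm dot3 pr_embed embed_last mulr0 addr0.
Qed.

Lemma cwd_inj (B : cc R 2) d d' : cwd d B -> cwd d' B -> d = d'.
Proof. by move=> Bd Bd'; rewrite -(Bd _ (enorm_cis 0)) (Bd' _ (enorm_cis 0)). Qed.

(** The distance [d] is already used up horizontally. *)
Lemma eq_height d K x y : diam_le d K -> body K x -> body K y ->
  edist (pr x) (pr y) = d -> height x = height y.
Proof.
move=> Kd Kx Ky xyd; apply/eqP; rewrite -subr_eq0 -sqrf_eq0 eq_le sqr_ge0 andbT.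
have := Kd _ _ Kx Ky; rewrite -ler_sqr ?nnegrE ?edist_ge0//.
  by rewrite sqr_edist3 xyd gerDl.
by rewrite -xyd edist_ge0.
Qed.

(** The vertices [n] and [n + 1] are both joined by a longest diagonal to the
    vertex [n - k], so the heights above them agree with the height above that
    vertex. *)
Lemma polygon_lift_flat k K : diam_le (polygon_diam k) K ->
    polygon k `<=` body (pr_cc K) ->
  forall n : nat, (n <= k)%N -> forall x y, body K x -> body K y ->
    pr x = vertex k 0 -> pr y = vertex k n -> height x = height y.
Proof.
move=> Kd VK n nk x y Kx Ky xv; elim: n => [|n IH] in nk y Ky *.
  move=> yv.
  have [|z Kz zv] := VK (vertex k (- k%:Z)).
    by exists (- k%:Z) => //=; rewrite abszN.
  have opp := edist_vertex_opposite k 0; rewrite sub0r in opp.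
  by rewrite (eq_height Kd Kx Kz) ?(eq_height Kd Ky Kz) ?xv ?yv ?zv.
move=> yv.
have [|z Kz zv] := VK (vertex k (n%:Z - k%:Z)).
  by exists (n%:Z - k%:Z) => //=; rewrite distnEr ?leq_subr// ltnW.
have [|t Kt tv] := VK (vertex k n).
  by exists n%:Z => //=; exact: ltnW.
rewrite (IH (ltnW nk) t Kt tv).
rewrite (eq_height Kd Kt Kz) ?(eq_height Kd Ky Kz) ?tv ?yv ?zv//.
  exact: edist_vertex_oppositeS.
exact: edist_vertex_opposite.
Qed.

End Heights.

(** * A body over the disc whose equator is not horizontal *)

Section BentBody.
Context {R : realType}.
Implicit Types (x y q : 'rV[R]_3) (u w : 'rV[R]_2) (K : cc R 3).

(** Antipodal points have the same height and are at distance 2; any bend of the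
    circle with that symmetry and a small enough slope has diameter 2. *)
Definition bent_circle : set 'rV[R]_3 :=
  [set x | enorm (pr x) = 1 /\ height x = `|pr x 0 ord0|].

Lemma bent_circle_over u : enorm u = 1 ->
  exists2 x, bent_circle x & pr x = u.
Proof.
move=> u1; pose x : 'rV[R]_3 := @row_mx R 1 2 1 u (`|u 0 ord0|)%:M.
have xu : pr x = u by exact: row_mxKl.
exists x => //; split; rewrite xu// /height.
have -> : ord_max = @rshift 2 1 ord0 by exact: val_inj.
by rewrite [LHS](@row_mxEr _ _ 2 1) mxE.
Qed.

(** If [u] and [v] are the shadows, then [|u - v|^2 + |u + v|^2 = 4], and the
    difference of the heights is at most [|u_0 + v_0| <= |u + v|]. *)
Lemma bent_circle_diam : diam_le 2 bent_circle.
Proof.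
move=> x y [x1 xz] [y1 yz].
rewrite -ler_sqr ?nnegrE ?edist_ge0// sqr_edist3 xz yz.
move: (pr x) (pr y) x1 y1 => u v u1 v1 {x y xz yz}.
have uu : dot u u = 1 by rewrite -sqr_enorm u1 expr1n.
have vv : dot v v = 1 by rewrite -sqr_enorm v1 expr1n.
have h : (`|u 0 ord0| - `|v 0 ord0|) ^+ 2 <= enorm (u + v) ^+ 2.
  rewrite -[leLHS]real_normK ?num_real// ler_sqr ?nnegrE ?enorm_ge0//.
  apply: le_trans (coord_le_enorm (u + v) ord0); rewrite mxE.
  by rewrite -[v 0 ord0]opprK normrN; exact: ler_dist_dist.
rewrite sqr_enorm in h; apply: le_trans (lerD (lexx _) h) _.
by rewrite sqr_enorm !dotE uu vv; lra.
Qed.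

Lemma exists_bent_body : exists2 K, bent_circle `<=` body K & cwd 2 K.
Proof.
apply: exists_cwd => //; last exact: bent_circle_diam.
by have [x bx _] := bent_circle_over (enorm_cis 0); exists x.
Qed.

(** The shadows of [x] and [q] are at distance at least [2 - e], so little of the
    diameter is left for the difference of heights.  This makes the height on a
    body of constant width 2 above the disc continuous along the circle. *)
Lemma height_near_antipode K x q w e : diam_le 2 K -> body K x -> body K q ->
    enorm w = 1 -> pr q = - w -> edist (pr x) w <= e -> e <= 2 ->
  (height x - height q) ^+ 2 <= 4 * e.
Proof.
move=> K2 Kx Kq w1 qw xw e2.
have e0 : 0 <= e := le_trans (edist_ge0 _ _) xw.
have far : 2 - e <= edist (pr x) (pr q).
  have := edist_triangle (pr x) w (- w); rewrite qw (edistC w (pr x)).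
  have -> : edist w (- w) = 2.
    by rewrite /edist opprK -mulr2n -scaler_nat enormZ w1 mulr1 ger0_norm.
  lra.
have := K2 _ _ Kx Kq; rewrite -ler_sqr ?nnegrE ?edist_ge0// sqr_edist3.
have : (2 - e) ^+ 2 <= edist (pr x) (pr q) ^+ 2.
  by rewrite ler_sqr ?nnegrE ?edist_ge0// subr_ge0.
have := sqr_ge0 e; nra.
Qed.

Lemma bent_body_not_flat K (L : cc R 3) x y e :
    bent_circle `<=` body K -> diam_le 2 K -> e <= 64^-1 ->
    hausdorff_dist K L <= e -> body L x -> body L y ->
    edist (pr x) (cis 0) <= e -> edist (pr y) (cis (pi / 2)) <= e ->
  height x <> height y.
Proof.
move=> bK K2 e64 KL Lx Ly x0 yp xy.
have near z t : body L z -> edist (pr z) (cis t) <= e ->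
    exists2 r, `|r - height z| <= e & (r - `|cos t|) ^+ 2 <= 8 * e.
  move=> Lz zt; have [a Ka za] := dist_to_set_attained K z.
  have {}za : edist a z <= e.
    rewrite edistC -za; apply: le_trans (dist_to_set_le_excess K Lz) _.
    by apply: le_trans KL; rewrite /hausdorff_dist le_max lexx orbT.
  have t1 : enorm (- cis t : 'rV[R]_2) = 1 by rewrite enormN enorm_cis.
  (* [q] is the point of the curve opposite to [cis t]; it has the same height
     as the point above [cis t]. *)
  have [q bq qt] := bent_circle_over t1.
  exists (height a); first exact: le_trans (height_dist_le _ _) za.
  have -> : `|cos t| = height q by rewrite bq.2 qt !mxE normrN.
  have -> : 8 * e = 4 * (e + e) by ring.
  apply: (height_near_antipode K2 Ka (bK _ bq) (enorm_cis t) qt).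
    apply: le_trans (edist_triangle (pr z) _ _) _; apply: lerD => //.
    exact: le_trans (edist_pr_le _ _) za.
  by lra.
have [r + +] := near _ _ Lx x0; have [s + +] := near _ _ Ly yp.
rewrite cos0 cos_pihalf normr0 normr1 subr0 -xy !ler_norml.
move=> /andP[s1 s2] s3 /andP[r1 r2] r3.
have rs : r - s <= 32^-1 by lra.
have s4 : s < 3 / 8 by rewrite ltNge; apply/negP => ?; nra.
have r4 : 5 / 8 < r by rewrite ltNge; apply/negP => ?; nra.
lra.
Qed.

End BentBody.

(** * The projection is not 0-soft *)

Section NotSoft.
Context {R : realType}.

Lemma polygon_bodies_cvg (A : cc R 3) (B : nat -> cc R 2) :
    bent_circle `<=` body A -> diam_le 2 A ->
    (forall n, polygon n.+1 `<=` body (B n)) ->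
    (forall n, cwd (polygon_diam n.+1) (B n)) ->
  B n @[n --> \oo] --> pr_cc A.
Proof.
move=> bA A2 VB Bd.
have le_mesh n : hausdorff_dist (pr_cc A) (B n) <= mesh n.+1.
  apply: hausdorff_dist_disc_le.
  - by move=> u /bent_circle_over[x bx <-]; exists x => //; exact: bA.
  - move=> _ _ [x Ax <-] [y Ay <-]; apply: le_trans (edist_pr_le _ _) _.
    exact: A2.
  - move=> x y Bx By; apply: le_trans (@polygon_diam_le2 R n.+1).
    by apply: cwd_diam_le (Bd n) _ _ Bx By; rewrite ltW// polygon_diam_gt0.
  - move=> u u1; have [v Vv uv] := @polygon_dense R n.+1 u isT u1.
    by exists v => //; exact: VB.
apply/cvg_ballP => e e0; near=> n.
rewrite ballEmdist/=; apply: le_lt_trans (le_mesh n) _.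
near: n.
have : mesh n.+1 @[n --> \oo] --> (0 : R).
  by rewrite (cvg_shiftS (@mesh R)); exact: mesh_cvg0.
move=> /cvgr_lt; exact.
Unshelve. all: by end_near. Qed.

End NotSoft.

Theorem theorem2p1 (R : realType) : ~ soft 0 (@cw_pr R).
Proof.
have [A bA Acw] := @exists_bent_body R.
have A2 : diam_le 2 A by exact: cwd_diam_le Acw.
pose A' : cw R 3 := SigSub (mem_set (ex_intro2 _ _ 2 (ltr0n R 2) Acw)).
have /choice[B HB] n : exists B : cw R 2, polygon n.+1 `<=` body (val B) /\
    cwd (polygon_diam n.+1) (val B).
  have d0 := @polygon_diam_gt0 R n.+1 isT.
  have V0 : @polygon R n.+1 !=set0 by exists (vertex n.+1 0), 0.
  have [K VK Kd] := exists_cwd d0 V0 (@polygon_diam_le R n.+1).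
  have Kcw : cw R 2 K by exists (polygon_diam n.+1).
  by exists (SigSub (mem_set Kcw)).
pose natoo : topologicalType := one_point_compactification nat.
pose phi (z : natoo) : cw R 2 := if z is Some n then B n else cw_pr A'.
have phic : continuous phi.
  apply: continuous_comp_initial; apply: natoo_continuous.
  by apply: (polygon_bodies_cvg bA A2) => n; have [] := HB n.
pose pt : topologicalType := set_type [set (None : natoo)].
pose i : pt -> natoo := set_val.
have i_emb : closed_embedding i.
  split; [exact: initial_continuous|exact: val_inj|].
  move=> C _.
  have /accessible_finite_set_closed := hausdorff_accessible natoo_hausdorff.
  apply.
  apply: (@sub_finite_set _ _ [set (None : natoo)]) => // _ [[z zN] _ <-].
  exact: set_mem zN.
have psic : continuous (fun _ : pt => A') by exact: cst_continuous.
pose psi' : continuousType pt (cw R 3) :=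
  HB.pack (fun _ : pt => A') (isContinuous.Build _ _ _ psic).
pose phi' : continuousType natoo (cw R 2) :=
  HB.pack phi (isContinuous.Build _ _ _ phic).
move=> /(_ natoo pt i natoo_paracompact natoo_covering_dim0 i_emb psi' phi').
case.
  apply/funext => z; have iz : i z = None := set_valP z.
  by rewrite /= iz.
move=> Phi [Phipsi Phiphi].
have PhiN : Phi None = A'.
  have <- : i (SigSub (mem_set (erefl : [set (None : natoo)] None))) = None by [].
  by rewrite -[LHS]/((Phi \o i) _) Phipsi.
(* [L n] converges to [A] and lifts [B n]; for large [n] this is
   contradictory. *)
pose L n := val (Phi (Some n)).
have LB n : pr_cc (L n) = val (B n).
  by rewrite -[RHS]/(val (phi (Some n))) -[phi]Phiphi.
have diamL n : diam_le (polygon_diam n.+1) (L n).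
  have [d d0 Ld] := set_valP (Phi (Some n)).
  have := cwd_pr Ld; rewrite LB => /cwd_inj/(_ (HB n).2) <-.
  exact: cwd_diam_le (ltW d0) Ld.
pose e : R := 64^-1; have e0 : 0 < e by rewrite invr_gt0.
have LA : \forall n \near \oo, hausdorff_dist A (L n) <= e.
  have Phic : continuous (set_val \o Phi : natoo -> cc R 3).
    move=> z; apply: continuous_comp; first exact: cts_fun.
    exact: initial_continuous.
  have : nbhs (None : natoo) ((set_val \o Phi) @^-1` ball A e).
    by apply: (Phic None (ball A e)); rewrite /= PhiN; exact: nbhsx_ballx.
  move=> /nbhs_natoo[_]; apply: filterS => n /=.
  by rewrite ballEmdist; exact: ltW.
have mesh_e : \forall n \near \oo, mesh n.+1 <= e.
  have : mesh n.+1 @[n --> \oo] --> (0 : R).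
    by rewrite (cvg_shiftS (@mesh R)); exact: mesh_cvg0.
  by move=> /cvgr_le; apply.
have [n [LAn me]] := filter_ex (filterI LA mesh_e).
have VL : polygon n.+1 `<=` body (pr_cc (L n)) by rewrite LB; exact: (HB n).1.
have pi2 : 0 <= (pi : R) / 2 <= pi by have := @pi_ge0 R; lra.
(* A vertex of nonnegative index close to (0, 1): the chain of diagonals links
   it to the vertex 0, which is (1, 0). *)
have [m mn vm] := near_vertex (ltn0Sn n) pi2.
have [|x Lx xv] := VL (vertex n.+1 0); first by exists 0.
have [|y Ly yv] := VL (vertex n.+1 m); first by exists m%:Z.
have x0 : edist (pr x) (cis 0) <= e by rewrite xv /vertex mul0r edistxx ltW.
have ypi2 : edist (pr y) (cis (pi / 2)) <= e.
  by rewrite yv edistC; exact: le_trans vm me.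
have := bent_body_not_flat bA A2 (lexx _) LAn Lx Ly x0 ypi2; apply.
exact: polygon_lift_flat (diamL n) VL m mn x y Lx Ly xv yv.
Qed.
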